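(* Let $\psi\colon\mathbb{N}\to\mathbb{R}^+$ be a positive function satisfying $\sum_{n=1}^{\infty}\frac{1}{\psi(n)}<\infty$, and let $\mathfrak{M}$ be a subset of $\mathbb{N}^{\mathbb{N}}$ such that every sequence $(a_n)_{n=1}^\infty$ in $\mathfrak{M}$ satisfies $a_n\geq\psi(n)$ for all sufficiently large $n$, and $a_1\geq 2$. Then $$\dim_H\left\{x\in(0,1)\setminus\mathbb{Q}\colon (q_n(x))_{n=1}^\infty\in\mathfrak{M}\right\}=\dim_H\left\{x\in(0,1)\setminus\mathbb{Q}\colon (\widetilde{q}_n(x))_{n=1}^\infty\in\mathfrak{M}\right\},$$ where $q_n(x)$ and $\widetilde{q}_n(x)$ denote the $n$th digits of the Pierce expansion of $x$ in the Perron notation and in the traditional notation, respectively, and $\dim_H$ is the Hausdorff dimension.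
   Context: $\mathbb{N}=\{1,2,3,\dots\}$. Pierce expansion in the Perron notation: every $x\in(0,1)\setminus\mathbb{Q}$ has a unique representation $$x=\frac{1}{q_1-1}-\frac{1}{(q_1-1)(q_2-1)}+\frac{1}{(q_1-1)(q_2-1)(q_3-1)}-\cdots$$ as an infinite series, with natural numbers $q_1\ge2$ and $q_{n+1}\ge q_n+1$ for all $n$; put $q_n(x)=q_n$. Pierce expansion in the traditional notation: the same expansion written as $$x=\frac{1}{\widetilde{q}_1}-\frac{1}{\widetilde{q}_1\widetilde{q}_2}+\cdots+\frac{(-1)^{n-1}}{\widetilde{q}_1\cdots\widetilde{q}_n}+\cdots,$$ so that $\widetilde{q}_n(x)=q_n(x)-1$ for all $n$ (thus $\widetilde q_1(x)\ge1$ and $(\widetilde q_n(x))_n$ is strictly increasing). *)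

(* Defs.v *)
From HB Require Import structures.
From mathcomp Require Import all_boot all_order all_algebra.
From mathcomp Require Import all_classical all_reals all_analysis.
Import Order.TTheory GRing.Theory Num.Theory.
Import numFieldNormedType.Exports.

Set Implicit Arguments.
Unset Strict Implicit.
Unset Printing Implicit Defensive.

Local Open Scope classical_set_scope.
Local Open Scope ring_scope.

(** Sequences indexed by {1, 2, ...} are reindexed from 0: [q n] is the (n+1)-st digit. *)

Definition perron_pierce_expansion (R : realType) (x : R) (q : nat -> nat) : Prop :=
  [/\ (2 <= q 0)%N, (forall n, (q n + 1 <= q n.+1)%N) &
      series (fun n => (-1) ^+ n / \prod_(i < n.+1) ((q i)%:R - 1)) @ \oo --> x].

Definition traditional_pierce_expansion (R : realType) (x : R) (q : nat -> nat) : Prop :=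
  [/\ (1 <= q 0)%N, (forall n, (q n < q n.+1)%N) &
      series (fun n => (-1) ^+ n / \prod_(i < n.+1) (q i)%:R) @ \oo --> x].

(** Every irrational [x] in (0, 1) has exactly one expansion of each kind, which
    [xget] selects; when there is none the digits are all 0. *)
Definition perron_digits (R : realType) (x : R) : nat -> nat :=
  xget (fun=> 0%N) [set q | perron_pierce_expansion x q].

Definition traditional_digits (R : realType) (x : R) : nat -> nat :=
  xget (fun=> 0%N) [set q | traditional_pierce_expansion x q].

(** The two notations denote the same series, up to shifting the digits by 1. *)
Lemma perron_traditional (R : realType) (x : R) (q : nat -> nat) :
  perron_pierce_expansion x (fun n => (q n).+1) <->
  traditional_pierce_expansion x q.
Proof.
have E : (fun n => (-1) ^+ n / \prod_(i < n.+1) ((q i).+1%:R - 1)) =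
         (fun n => (-1) ^+ n / \prod_(i < n.+1) (q i)%:R) :> (nat -> R).
  apply/funext => n; congr (_ / _); apply: eq_bigr => i _.
  by rewrite -natr1 addrK.
rewrite /perron_pierce_expansion E.
by split=> -[h0 h1 h2]; split=> // n; have := h1 n; rewrite addn1.
Qed.

Local Open Scope ereal_scope.

(** [ereal_sup set0 = -oo], hence the maximum with 0. *)
Definition diameter (R : realType) (A : set R) : \bar R :=
  maxe 0 (ereal_sup [set `|xy.1 - xy.2|%:E | xy in A `*` A]).

(** [diam(A)^s], with [diam(set0)^s = 0] also when [s = 0]; for nonempty [A],
    [poweR] gives [diam(A)^0 = 1]. *)
Definition diameter_pow (R : realType) (s : R) (A : set R) : \bar R :=
  if A == set0 then 0 else diameter A `^ s.

Definition hausdorff_premeasure (R : realType) (s delta : R) (A : set R) : \bar R :=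
  ereal_inf [set \sum_(0 <= i <oo) diameter_pow s (U i) | U in
    [set U : nat -> set R | A `<=` \bigcup_i U i /\
                            forall i, diameter (U i) <= delta%:E]].

Definition hausdorff_measure (R : realType) (s : R) (A : set R) : \bar R :=
  ereal_sup [set hausdorff_premeasure s delta A | delta in [set d : R | (0 < d)%R]].

Definition hausdorff_dim (R : realType) (A : set R) : \bar R :=
  ereal_inf [set s%:E | s in [set s : R | (0 <= s)%R /\ hausdorff_measure s A = 0]].

(* Main.v *)
Require Import Defs.
From mathcomp Require Import all_boot all_order all_algebra.
From mathcomp Require Import all_classical all_reals all_analysis.
From mathcomp Require Import ring lra zify.
Import Order.TTheory GRing.Theory Num.Theory.
Import numFieldNormedType.Exports.

Local Open Scope classical_set_scope.
Local Open Scope ring_scope.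

Set Implicit Arguments.
Unset Strict Implicit.
Unset Printing Implicit Defensive.

(** The theorem holds because increasing all digits of a Pierce expansion by [1]
    is Lipschitz, and its inverse is a countable union of Lipschitz maps.

    Both sets are first rewritten with traditional expansions: the Perron set
    consists of the sums with digits [c], the traditional one of the sums with
    digits [c + 1], where [c + 1] ranges over the increasing sequences of [M].
    This uses that every increasing sequence of positive integers is the
    expansion of a number ([pierce_expansion_exists]), which is irrational
    ([pierce_expansion_irrational]) and determines the sequence
    ([pierce_expansion_unique]).

    Let [x], [y] have expansions [a], [b] that first differ at index [n]. Then
    [|x - y|] is the product of the [1 / a i], [i < n], times the distance of
    the [n]-th remainders. The latter distance is a quotient whose numerator is
    a sum of nonnegative terms ([pierce_gapE]), each of which changes by a
    bounded factor under the digit shift ([pierce_gap_shift]). Hence the shift is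
    2-Lipschitz, and its inverse is Lipschitz with a constant proportional to
    the product of the [1 + 1 / a i] ([pierce_distortion]).

    If [a + 1] belongs to [M], these products are bounded, because the reciprocals
    of the digits are summable ([shift_product_bounded]). So the Perron set is a
    countable union of pieces on which the bound is a fixed integer, each the
    Lipschitz image of a part of the traditional set. Sets of measure zero are
    preserved by Lipschitz correspondences ([hausdorff_null_lipschitz]) and by
    countable unions ([hausdorff_null_bigcup]), so that the two sets are null for
    the same exponents. *)

(** * Pierce expansions and the remainder map *)

Local Notation pierce_term R q := (fun n : nat =>
  (-1) ^+ n / \prod_(i < n.+1) (q i)%:R : R).

Lemma pierce_series_recl (R : realType) (q : nat -> nat) n :
  series (pierce_term R q) n.+1 =
  (1 - series (pierce_term R (fun i => q i.+1)) n) / (q 0%N)%:R.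
Proof.
rewrite /series /= big_nat_recl// big_ord_recl big_ord0 expr0 mulr1 mulrBl.
congr (_ + _); rewrite big_distrl /= -sumrN; apply: eq_bigr => i _.
by rewrite [in LHS]big_ord_recl /= exprS invfM; ring.
Qed.

Lemma pierce_series_bound (R : realType) n (q : nat -> nat) :
  (1 <= q 0)%N -> (forall i, q i < q i.+1)%N ->
  0 <= series (pierce_term R q) n <= (q 0%N)%:R^-1.
Proof.
elim: n q => [|n IHn] q q0 qS.
  by rewrite /series /= big_geq// lexx invr_ge0 ler0n.
have q1 : (1 <= q 1)%N by apply: leq_trans (qS 0%N).
have /andP[s0 s1] := IHn (fun i => q i.+1) q1 (fun i => qS i.+1).
have s_le1 : series (pierce_term R (fun i => q i.+1)) n <= 1.
  by rewrite (le_trans s1)// invf_le1 ?ltr0n// ler1n.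
rewrite pierce_series_recl divr_ge0 ?subr_ge0//=.
by rewrite ler_pdivrMr ?ltr0n// mulVf ?pnatr_eq0 -?lt0n// lerBlDr lerDl.
Qed.

Lemma increasing_digits_gt (q : nat -> nat) :
  (1 <= q 0)%N -> (forall i, q i < q i.+1)%N -> forall n, (n < q n)%N.
Proof. by move=> q0 qS; elim=> // n IHn; exact: leq_ltn_trans (qS n). Qed.

(** Since the digits increase, the [n]-th term of the series is at most
    [1 / (n + 1)!] in absolute value. *)
Lemma pierce_expansion_exists (R : realType) (q : nat -> nat) :
  (1 <= q 0)%N -> (forall i, q i < q i.+1)%N ->
  exists x : R, traditional_pierce_expansion x q.
Proof.
move=> q0 qS; have q_gt := increasing_digits_gt q0 qS.
have prod_ge n : (n`!)%:R <= \prod_(i < n.+1) (q i)%:R :> R.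
  rewrite big_ord_recl -natr_prod -natrM ler_nat fact_prod.
  rewrite -[leqLHS]mul1n leq_mul// big_add1 /= big_mkord.
  apply: leq_prod => i _; rewrite /bump /=; exact: ltnW.
suff cvg_pierce : cvgn (series (pierce_term R q)).
  by exists (limn (series (pierce_term R q))); split.
apply: normed_cvg; apply: (@series_le_cvg _ _ (exp_coeff 1)).
- by move=> n /=.
- by move=> n; rewrite exp_coeff_ge0.
- move=> n; rewrite /exp_coeff /= normrM normrX normrN1 !expr1n !mul1r normfV.
  have prod_gt0 : 0 < \prod_(i < n.+1) (q i)%:R :> R.
    by apply: lt_le_trans (prod_ge n); rewrite ltr0n fact_gt0.
  by rewrite gtr0_norm// lef_pV2 ?posrE// ltr0n fact_gt0.
- exact: is_cvg_series_exp_coeff.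
Qed.

Lemma pierce_expansion_tail (R : realType) (x : R) q :
  traditional_pierce_expansion x q ->
  traditional_pierce_expansion (1 - (q 0%N)%:R * x) (fun n => q n.+1).
Proof.
move=> [q0 qS qx]; split=> //; first exact: leq_trans (qS 0%N).
have q0_neq0 : (q 0%N)%:R != 0 :> R by rewrite pnatr_eq0 -lt0n.
have -> : series (pierce_term R (fun n => q n.+1)) =
    (fun n => 1 - (q 0%N)%:R * series (pierce_term R q) n.+1).
  by apply/funext => n; rewrite pierce_series_recl mulrC divfK// opprB addrC subrK.
apply: cvgB; first exact: cvg_cst.
by apply: cvgMr; rewrite cvg_shiftS.
Qed.

(** The first digit is the integer part of [1 / x]: the partial sums give
    [0 <= x <= 1 / q 0], and applying this to the first two remainders makes it
    strict and provides the lower bound. *)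
Lemma pierce_expansion_bounds (R : realType) (x : R) q :
  traditional_pierce_expansion x q ->
  (q 0%N).+1%:R^-1 < x < (q 0%N)%:R^-1.
Proof.
have weak (y : R) p : traditional_pierce_expansion y p -> 0 <= y <= (p 0%N)%:R^-1.
  move=> [p0 pS py]; have bd n := pierce_series_bound R n p0 pS.
  apply/andP; split.
    by apply: (ler_cvg_to (cvg_cst 0) py); near=> n; have /andP[] := bd n.
  by apply: (ler_cvg_to py (cvg_cst _)); near=> n; have /andP[] := bd n.
have pos (y : R) p : traditional_pierce_expansion y p -> 0 < y.
  move=> yp; have [p0 pS _] := yp.
  have /andP[_] := weak _ _ (pierce_expansion_tail yp).
  have p1 : (p 1%N)%:R^-1 < 1 :> R.
    have p01 := pS 0%N.
    by rewrite invf_lt1 ?ltr1n ?ltr0n ?(leq_ltn_trans p0)// (ltn_trans p0).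
  move=> /le_lt_trans /(_ p1); rewrite ltrBlDr ltrDl.
  by rewrite pmulr_rgt0 ?ltr0n.
have upper (y : R) p : traditional_pierce_expansion y p -> y < (p 0%N)%:R^-1.
  move=> yp; have [p0 pS _] := yp.
  have := pos _ _ (pierce_expansion_tail yp); rewrite subr_gt0 => y_lt.
  by rewrite -[ltRHS]mul1r ltr_pdivlMr ?ltr0n// mulrC.
move=> xq; have [q0 qS _] := xq; rewrite upper// andbT.
have := upper _ _ (pierce_expansion_tail xq).
have : (q 1%N)%:R^-1 <= (q 0%N).+1%:R^-1 :> R.
  by rewrite lef_pV2 ?posrE ?ltr0n ?ler_nat// (leq_ltn_trans _ (qS 0%N)).
move=> h1 /lt_le_trans /(_ h1); rewrite -natr1.
have q0' : 0 < (q 0%N)%:R :> R by rewrite ltr0n.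
rewrite ltrBlDr -ltrBlDl -{1}(@divff _ ((q 0%N)%:R + 1)) ?gt_eqF ?addr_gt0//.
by rewrite mulrDl mul1r addrK ltr_pM2l.
Unshelve. all: by end_near. Qed.

Lemma pierce_expansion_unique (R : realType) (x : R) q p :
  traditional_pierce_expansion x q -> traditional_pierce_expansion x p -> q = p.
Proof.
move=> xq xp; apply/funext => n.
have head (y : R) q' p' : traditional_pierce_expansion y q' ->
    traditional_pierce_expansion y p' -> (p' 0 <= q' 0)%N.
  move=> yq yp; have /andP[lq _] := pierce_expansion_bounds yq.
  have /andP[_ up] := pierce_expansion_bounds yp; have [p0 _ _] := yp.
  by have := lt_trans lq up; rewrite ltf_pV2 ?posrE ?ltr0n// ltr_nat.
elim: n x q p xq xp => [|n IHn] x q p xq xp.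
  by apply/eqP; rewrite eqn_leq (head x p q)// (head x q p).
apply: (IHn (1 - (q 0%N)%:R * x) (fun n => q n.+1) (fun n => p n.+1)).
  exact: pierce_expansion_tail.
have -> : q 0%N = p 0%N by apply/eqP; rewrite eqn_leq (head x p q)// (head x q p).
exact: pierce_expansion_tail.
Qed.

(** Passing to the remainder [1 - q 0 * x < x] keeps the denominator of a
    fraction and decreases its positive numerator: infinite descent. *)
Lemma pierce_expansion_irrational (R : realType) (x : R) q :
  traditional_pierce_expansion x q -> irrational x.
Proof.
move=> xq; have x_gt0 : 0 < x.
  by apply: lt_trans (andP (pierce_expansion_bounds xq)).1; rewrite invr_gt0 ltr0n.
have descent k (y : R) p a b : traditional_pierce_expansion y p ->
    (a <= k)%N -> y * b%:R = a%:R -> (0 < b)%N -> False.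
  elim: k y p a => [|k IHk] y p a yp ak ya b0.
    have /andP[ly _] := pierce_expansion_bounds yp.
    have : 0 < y * b%:R by rewrite mulr_gt0 ?ltr0n// (lt_trans _ ly)// invr_gt0 ltr0n.
    by rewrite ya ltr0n; case: a ak {ya}.
  have yp' := pierce_expansion_tail yp.
  have y'_gt0 : 0 < 1 - (p 0%N)%:R * y.
    by apply: lt_trans (andP (pierce_expansion_bounds yp')).1; rewrite invr_gt0 ltr0n.
  have b0' : 0 < b%:R :> R by rewrite ltr0n.
  have ab : (p 0 * a <= b)%N.
    rewrite -(ler_nat R) natrM -ya mulrA -subr_ge0 -{1}[b%:R]mul1r -mulrBl.
    by rewrite mulr_ge0 ?ltW.
  apply: (IHk _ _ (b - p 0 * a)%N yp') => //; last first.
    by rewrite natrB// natrM -ya; ring.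
  rewrite -ltnS; apply: leq_trans ak.
  rewrite -(ltr_nat R) natrB// natrM -ya.
  have /andP[ly _] := pierce_expansion_bounds yp.
  have : 1 < y * ((p 0%N)%:R + 1).
    by rewrite natr1 -ltr_pdivrMr ?ltr0n// div1r.
  by move: b0'; set B := b%:R; set P := (p 0%N)%:R; nra.
move=> /rationalP[a [b xab]].
have b0 : (0 < b)%N.
  by case: b xab x_gt0 => // ->; rewrite invr0 mulr0 ltxx.
have xb : x * b%:R = a%:~R by rewrite xab divfK// pnatr_eq0 -lt0n.
case: a xb {xab} => a xb; first exact: (descent a x q a b).
have : 0 < x * b%:R by rewrite mulr_gt0 ?ltr0n.
by rewrite xb NegzE mulrNz oppr_gt0 ltNge ler0n.
Qed.

Lemma perron_digitsE (R : realType) (x : R) q :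
  traditional_pierce_expansion x q -> perron_digits x = fun n => (q n).+1.
Proof.
move=> /perron_traditional xq; apply: xget_unique => // p xp.
have [p0 pS _] := xp.
have pE : p = fun n => (p n).-1.+1.
  apply/funext => n; rewrite prednK//.
  case: n => [|n]; first exact: ltnW.
  by apply: leq_trans (pS n); rewrite addn1.
move: xp; rewrite pE => /perron_traditional xp.
move: xq => /perron_traditional xq.
by rewrite -(pierce_expansion_unique xp xq).
Qed.

Lemma traditional_digitsE (R : realType) (x : R) q :
  traditional_pierce_expansion x q -> traditional_digits x = q.
Proof.
by move=> xq; apply: xget_unique => // p xp; exact: pierce_expansion_unique xp xq.
Qed.

(** * Distortion of the digit shift *)

(** If the expansions start with [m < k], then [m * k * (x - y)] is a sum of
    three nonnegative terms. The integers [k - m - 1] and [p - m - 1] do not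
    change when all digits increase by [1], and every other factor changes by a
    bounded ratio; a direct bound on [x - y] would fail, since for [k = m + 1]
    and [p = m + 1] it is governed by the later remainders [r] and [t]. *)
Lemma pierce_gapE (R : realType) (m k p r t : R) :
  m != 0 -> k != 0 -> p != 0 ->
  (1 - (1 - r) / p) / m - (1 - t) / k =
  ((k - m - 1) * (1 - (1 - r) / p) + ((p - m - 1) + (m + 1) * r) / p + m * t)
  / (m * k).
Proof. by move=> m0 k0 p0; field; rewrite m0 k0 p0. Qed.

(** [r' < 1 / (q 0 + 1) < r], and [r < 1 / q 0 <= 3 / (q 0 + 2) < 3 * r']. *)
Lemma pierce_remainder_shift (R : realType) (r r' : R) q :
  traditional_pierce_expansion r q ->
  traditional_pierce_expansion r' (fun n => (q n).+1) ->
  [/\ 0 < r', r' <= r & r <= 3 * r'].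
Proof.
move=> rq rq'; have [q0 _ _] := rq.
have /andP[l u] := pierce_expansion_bounds rq.
have /andP[l' u'] := pierce_expansion_bounds rq'.
split; first by apply: lt_trans l'; rewrite invr_gt0 ltr0n.
  exact/ltW/(lt_trans u').
apply: le_trans (ltW u) _; apply: le_trans (_ : 3 * (q 0%N).+2%:R^-1 <= _); last first.
  by rewrite ler_pM2l// ltW.
rewrite ler_pdivlMr ?ltr0n// mulrC ler_pdivrMr ?ltr0n// -natrM ler_nat.
by move: q0; lia.
Qed.

(** The gaps [d] and [d'] before and after the shift are compared term by term in
    the decomposition [pierce_gapE]. The numerators satisfy [N' <= 2 * N] and
    [N <= 6 * N'], the factor [6] coming from [r <= 3 * r'] and [p + 1 <= 2 * p];
    the denominators differ by a factor at most [4]. *)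
Lemma pierce_gap_shift (R : realType) (m k p r t s d r' t' s' d' : R) :
  s = (1 - r) / p -> d = (1 - s) / m - (1 - t) / k ->
  s' = (1 - r') / (p + 1) -> d' = (1 - s') / (m + 1) - (1 - t') / (k + 1) ->
  1 <= m -> m + 1 <= k -> m + 1 <= p ->
  r <= 1 -> 0 < r' -> r' <= r -> r <= 3 * r' ->
  0 < t' -> t' <= t -> t <= 3 * t' ->
  s <= 2^-1 -> s' <= s ->
  [/\ 0 <= d', d' <= 2 * d & d <= 24 * d'].
Proof.
move=> sE dE0 s'E d'E0 m1 mk mp r1 r'0 r'r rr' t'0 t't tt' s2 s's.
have [m0 k0 p0] : [/\ 0 < m, 0 < k & 0 < p] by split; lra.
have s'0 : 0 <= s' by rewrite s'E divr_ge0; lra.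
pose N := (k - m - 1) * (1 - s) + ((p - m - 1) + (m + 1) * r) / p + m * t.
pose N' := (k - m - 1) * (1 - s') + ((p - m - 1) + (m + 2) * r') / (p + 1)
           + (m + 1) * t'.
have dE : d = N / (m * k) by rewrite dE0 /N sE pierce_gapE// gt_eqF.
have d'E : d' = N' / ((m + 1) * (k + 1)).
  have -> : N' = ((k + 1) - (m + 1) - 1) * (1 - s')
      + (((p + 1) - (m + 1) - 1) + ((m + 1) + 1) * r') / (p + 1) + (m + 1) * t'.
    rewrite /N'; have -> : m + 1 + 1 = m + 2 by ring.
    by congr (_ * _ + _ / _ + _); ring.
  by rewrite d'E0 s'E pierce_gapE// gt_eqF; lra.
have first_le : (k - m - 1) * (1 - s') <= 2 * ((k - m - 1) * (1 - s)).
  by rewrite mulrCA ler_wpM2l; lra.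
have first_ge : (k - m - 1) * (1 - s) <= (k - m - 1) * (1 - s').
  by rewrite ler_wpM2l; lra.
have first_ge0 : 0 <= (k - m - 1) * (1 - s) by rewrite mulr_ge0; lra.
have num_ge0 : 0 <= (p - m - 1) + (m + 1) * r by rewrite addr_ge0 ?mulr_ge0; lra.
have num'_ge0 : 0 <= (p - m - 1) + (m + 2) * r' by rewrite addr_ge0 ?mulr_ge0; lra.
have second_le : ((p - m - 1) + (m + 2) * r') / (p + 1) <=
    2 * (((p - m - 1) + (m + 1) * r) / p).
  rewrite ler_pdivrMr; last lra.
  apply: le_trans (_ : 2 * ((p - m - 1 + (m + 1) * r) / p) * p <= _).
    rewrite mulrA divfK; last by rewrite gt_eqF.
    by nra.
  rewrite ler_wpM2l//; last lra.
  by rewrite mulr_ge0// divr_ge0// ltW.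
have second_ge : ((p - m - 1) + (m + 1) * r) / p <=
    6 * (((p - m - 1) + (m + 2) * r') / (p + 1)).
  rewrite ler_pdivrMr//.
  apply: le_trans (_ : 3 * ((p - m - 1 + (m + 2) * r') / (p + 1)) * (p + 1) <= _).
    by rewrite mulrA divfK; [nra | rewrite gt_eqF; lra].
  set X := _ / (p + 1).
  have X0 : 0 <= X by rewrite divr_ge0//; lra.
  by nra.
have second_ge0 : 0 <= ((p - m - 1) + (m + 1) * r) / p.
  by rewrite divr_ge0// ltW.
have third_le : (m + 1) * t' <= 2 * (m * t) by nra.
have third_ge : m * t <= 3 * ((m + 1) * t') by nra.
have third_ge0 : 0 <= m * t by rewrite mulr_ge0; lra.
have N0 : 0 <= N by rewrite /N; lra.
have N'N : N' <= 2 * N by rewrite /N' /N; lra.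
have NN' : N <= 6 * N' by rewrite /N' /N; lra.
have mk0 : 0 < m * k by rewrite mulr_gt0.
have mk1 : m * k <= (m + 1) * (k + 1) by nra.
have mk4 : (m + 1) * (k + 1) <= 4 * (m * k) by nra.
rewrite dE d'E; split; first by rewrite divr_ge0//; nra.
  rewrite ler_pdivrMr; last lra.
  apply: le_trans (_ : 2 * (N / (m * k)) * (m * k) <= _).
    by rewrite -mulrA divfK// gt_eqF.
  by rewrite ler_wpM2l// mulr_ge0// divr_ge0// ltW.
rewrite ler_pdivrMr//.
apply: le_trans (_ : 6 * (N' / ((m + 1) * (k + 1))) * ((m + 1) * (k + 1)) <= _).
  by rewrite -mulrA divfK// gt_eqF; lra.
set X := N' / _; have X0 : 0 <= X by rewrite divr_ge0; lra.
by nra.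
Qed.

Lemma pierce_first_digit_distortion (R : realType) (x y x' y' : R) a b :
  traditional_pierce_expansion x a -> traditional_pierce_expansion y b ->
  traditional_pierce_expansion x' (fun n => (a n).+1) ->
  traditional_pierce_expansion y' (fun n => (b n).+1) ->
  (a 0 < b 0)%N ->
  [/\ `|x' - y'| <= 2 * `|x - y| & `|x - y| <= 24 * `|x' - y'|].
Proof.
move=> xa yb xa' yb' ab.
have [a0 aS _] := xa; have [b0 bS _] := yb.
have sa := pierce_expansion_tail xa; have sa' := pierce_expansion_tail xa'.
have [_ s's _] := pierce_remainder_shift sa sa'.
have rb := pierce_expansion_tail sa; have rb' := pierce_expansion_tail sa'.
have [r'0 r'r rr'] := pierce_remainder_shift rb rb'.
have [t'0 t't tt'] := pierce_remainder_shift
  (pierce_expansion_tail yb) (pierce_expansion_tail yb').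
have /andP[_ s_lt] := pierce_expansion_bounds sa.
have /andP[_ r_lt] := pierce_expansion_bounds rb.
set s := 1 - (a 0%N)%:R * x in sa s's rb r'r rr' s_lt r_lt *.
set s' := 1 - (a 0%N).+1%:R * x' in sa' s's rb' r'0 r'r rr' *.
set t := 1 - (b 0%N)%:R * y in t't tt' *.
set t' := 1 - (b 0%N).+1%:R * y' in t't tt' t'0 *.
set r := 1 - _ in rb r'r rr' r_lt; set r' := 1 - _ in rb' r'0 r'r rr'.
have nz n : n.+1%:R != 0 :> R by rewrite pnatr_eq0.
have nz' n : (0 < n)%N -> n%:R != 0 :> R by rewrite pnatr_eq0 -lt0n.
have a1 : (0 < a 1)%N by apply: leq_trans (aS 0%N).
(* A number is recovered from its first digit and its remainder. *)
have undo (c z : R) : c != 0 -> (1 - (1 - c * z)) / c = z by move=> ?; field.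
have sE : s = (1 - r) / (a 1%N)%:R by rewrite /r undo ?nz'.
have s'E : s' = (1 - r') / ((a 1%N)%:R + 1) by rewrite natr1 /r' undo.
have dE : x - y = (1 - s) / (a 0%N)%:R - (1 - t) / (b 0%N)%:R.
  by rewrite /s /t !undo ?nz'.
have d'E : x' - y' = (1 - s') / ((a 0%N)%:R + 1) - (1 - t') / ((b 0%N)%:R + 1).
  by rewrite !natr1 /s' /t' !undo.
have := pierce_gap_shift sE dE s'E d'E.
rewrite !natr1 ler1n !ler_nat => /(_ a0 ab (aS 0%N)).
have r1 : r <= 1.
  apply: ltW; apply: lt_le_trans r_lt _.
  by rewrite invf_le1 ?ltr0n ?ler1n; apply: leq_trans (aS 1%N).
have s2 : s <= 2^-1.
  apply: ltW; apply: lt_le_trans s_lt _.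
  by rewrite lef_pV2 ?posrE ?ltr0n// ler_nat; apply: leq_ltn_trans a0 (aS 0%N).
move=> /(_ r1 r'0 r'r rr' t'0 t't tt' s2 s's)[d'0 d'd dd'].
by rewrite !ger0_norm; lra.
Qed.

(** A common first digit [m] scales both distances: by [1 / m] before the shift
    and by [1 / (m + 1)] after it, which contributes the factor [1 + 1 / m]. *)
Lemma pierce_distortion_at (R : realType) n (x y x' y' : R) a b :
  traditional_pierce_expansion x a -> traditional_pierce_expansion y b ->
  traditional_pierce_expansion x' (fun n => (a n).+1) ->
  traditional_pierce_expansion y' (fun n => (b n).+1) ->
  (forall i, (i < n)%N -> a i = b i) -> (a n < b n)%N ->
  `|x' - y'| <= 2 * `|x - y| /\
  `|x - y| <= 24 * \prod_(i < n) (1 + (a i)%:R^-1) * `|x' - y'|.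
Proof.
elim: n x y x' y' a b => [|n IHn] x y x' y' a b xa yb xa' yb' eq_ab ab.
  rewrite big_ord0 mulr1.
  by have [] := pierce_first_digit_distortion xa yb xa' yb' ab.
have eq0 := eq_ab 0%N isT; have [a0 _ _] := xa.
have [] := IHn _ _ _ _ _ _ (pierce_expansion_tail xa) (pierce_expansion_tail yb)
  (pierce_expansion_tail xa') (pierce_expansion_tail yb') (fun i => eq_ab i.+1) ab.
have tailB (c u v : R) : 0 <= c -> `|1 - c * u - (1 - c * v)| = c * `|u - v|.
  move=> c0; rewrite -[in RHS](ger0_norm c0) -normrM -normrN; congr Num.norm; ring.
rewrite -eq0 !tailB// => h1 h2.
have a0' : 1 <= (a 0%N)%:R :> R by rewrite ler1n.
rewrite -natr1 in h1 h2.
have [u0 v0] : 0 <= `|x' - y'| /\ 0 <= `|x - y| by [].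
split; first by nra.
rewrite big_ord_recl -(@ler_pM2l _ (a 0%N)%:R); last by lra.
apply: le_trans h2 _; rewrite le_eqVlt; apply/orP; left; apply/eqP.
by rewrite /=; field; rewrite gt_eqF//; lra.
Qed.

(** Distinct sequences separate at a first index, where the distortion is
    controlled; which of the two digits is larger does not matter. *)
Lemma pierce_distortion (R : realType) (K : R) (x y x' y' : R) a b :
  traditional_pierce_expansion x a -> traditional_pierce_expansion y b ->
  traditional_pierce_expansion x' (fun n => (a n).+1) ->
  traditional_pierce_expansion y' (fun n => (b n).+1) ->
  `|x' - y'| <= 2 * `|x - y| /\
  ((forall n, \prod_(i < n) (1 + (a i)%:R^-1) <= K) ->
   (forall n, \prod_(i < n) (1 + (b i)%:R^-1) <= K) ->
   `|x - y| <= 24 * K * `|x' - y'|).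
Proof.
move=> xa yb xa' yb'.
have [[n abn]|/forallNP ab] := pselect (exists n, a n != b n); last first.
  have eq_ab : a = b by apply/funext => n; apply/eqP/negPn/negP/ab.
  have cvg_eq (u v : R) q : traditional_pierce_expansion u q ->
      traditional_pierce_expansion v q -> u = v.
    by move=> [_ _ uq] [_ _ vq]; exact: (cvg_unique _ uq vq).
  rewrite eq_ab in xa xa'.
  by rewrite (cvg_eq _ _ _ xa yb) (cvg_eq _ _ _ xa' yb') !subrr normr0 !mulr0.
have [{abn} n abn n_min] := ex_minnP (ex_intro (fun n => a n != b n) n abn).
have eq_ab i : (i < n)%N -> a i = b i.
  by move=> i_n; apply/eqP/negPn/negP => /n_min; rewrite leqNgt i_n.
have final (c : nat -> nat) u v : \prod_(i < n) (1 + (c i)%:R^-1) <= K ->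
    `|u| <= 24 * \prod_(i < n) (1 + (c i)%:R^-1) * `|v| -> `|u| <= 24 * K * `|v|.
  by move=> cK /le_trans; apply; rewrite ler_wpM2r// ler_wpM2l.
move: abn; rewrite neq_ltn => /orP[ab|ba].
  have [h1 h2] := pierce_distortion_at xa yb xa' yb' eq_ab ab.
  by split=> // aK _; apply: final h2.
have eq_ba i : (i < n)%N -> b i = a i by move=> /eq_ab.
have [h1 h2] := pierce_distortion_at yb xa yb' xa' eq_ba ba.
rewrite (distrC x' y') (distrC x y).
by split=> // _ bK; apply: final h2.
Qed.

(** * Sets of Hausdorff measure zero *)

Local Open Scope ereal_scope.

Lemma diameter_ge0 (R : realType) (A : set R) : 0 <= diameter A.
Proof. by rewrite le_max lexx. Qed.

Lemma diameter_pow_ge0 (R : realType) (s : R) (A : set R) : 0 <= diameter_pow s A.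
Proof. by rewrite /diameter_pow; case: ifP => // _; exact: poweR_ge0. Qed.

Lemma diameter_ub (R : realType) (A : set R) x y :
  A x -> A y -> `|x - y|%:E <= diameter A.
Proof.
move=> Ax Ay; rewrite le_max; apply/orP; right.
by apply: ereal_sup_ubound; exists (x, y).
Qed.

(** All premeasures are nonnegative, so their supremum vanishes exactly when each
    of the infima over covers does. *)
Lemma hausdorff_nullP (R : realType) (s : R) (A : set R) :
  hausdorff_measure s A = 0 <->
  forall d e : R, (0 < d)%R -> (0 < e)%R -> exists U : nat -> set R,
    [/\ A `<=` \bigcup_i U i, forall i, diameter (U i) <= d%:E &
        \sum_(0 <= i <oo) diameter_pow s (U i) <= e%:E].
Proof.
have sum_ge0 (U : nat -> set R) : 0 <= \sum_(0 <= i <oo) diameter_pow s (U i).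
  by apply: nneseries_ge0 => i _ _; exact: diameter_pow_ge0.
have premeasure_ge0 d : 0 <= hausdorff_premeasure s d A.
  by apply: le_ereal_inf_tmp => _ [U _ <-].
split=> [null d e d0 e0|cover].
  have premeasure0 : hausdorff_premeasure s d A = 0.
    apply/eqP; rewrite eq_le premeasure_ge0 andbT -null.
    by apply: ereal_sup_ubound; exists d.
  have [|_ [U [AU Ud] <-]] := @lb_ereal_inf_adherent _
      [set \sum_(0 <= i <oo) diameter_pow s (U i) | U in
        [set U : nat -> set R | A `<=` \bigcup_i U i /\
                                forall i, diameter (U i) <= d%:E]] _ e0.
    by rewrite -/(hausdorff_premeasure s d A) premeasure0.
  rewrite -/(hausdorff_premeasure s d A) premeasure0 add0e => Ue.
  by exists U; split=> //; exact: ltW.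
apply/eqP; rewrite eq_le; apply/andP; split; last first.
  by apply: le_trans (premeasure_ge0 1%R) _; apply: ereal_sup_ubound; exists 1%R => /=.
apply: ge_ereal_sup => _ [d d0 <-]; apply/lee_addgt0Pr => e e0; rewrite add0e.
have [U [AU Ud Ue]] := cover d e d0 e0.
by apply: le_trans Ue; apply: ereal_inf_lbound; exists U.
Qed.

Lemma hausdorff_null_sub (R : realType) (s : R) (A B : set R) :
  A `<=` B -> hausdorff_measure s B = 0 -> hausdorff_measure s A = 0.
Proof.
move=> AB /hausdorff_nullP null; apply/hausdorff_nullP => d e d0 e0.
have [U [BU Ud Ue]] := null d e d0 e0; exists U; split=> //.
exact: subset_trans AB BU.
Qed.

(** Covers of the [n]-th set of total weight at most [e / 2 ^ (n + 1)] combine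
    into one cover, enumerated along a bijection of [nat] with [nat * nat]. *)
Lemma hausdorff_null_bigcup (R : realType) (s : R) (A : nat -> set R) :
  (forall n, hausdorff_measure s (A n) = 0) ->
  hausdorff_measure s (\bigcup_n A n) = 0.
Proof.
move=> null; apply/hausdorff_nullP => d e d0 e0.
have [U hU] : {U : nat -> nat -> set R & forall n,
    [/\ A n `<=` \bigcup_i U n i, forall i, diameter (U n i) <= d%:E &
        \sum_(0 <= i <oo) diameter_pow s (U n i) <= (e / (2 ^ n.+1)%:R)%:E]}.
  apply: (@choice _ _ (fun n (V : nat -> set R) => [/\ A n `<=` \bigcup_i V i,
    forall i, diameter (V i) <= d%:E &
    \sum_(0 <= i <oo) diameter_pow s (V i) <= (e / (2 ^ n.+1)%:R)%:E])) => n.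
  by have /hausdorff_nullP := null n; apply => //; rewrite divr_gt0.
have /card_esym/ppcard_eqP[f] := card_nat2.
exists (uncurry U \o f); split.
- move=> x [n _ Anx]; have [AU _ _] := hU n; have [i _ Ux] := AU _ Anx.
  by exists (f^-1%FUN (n, i)) => //=; rewrite invK ?inE.
- by move=> i /=; have [_ Ud _] := hU (f i).1; rewrite /uncurry; case: (f i) Ud => ? ? /=.
pose w := diameter_pow s \o uncurry U.
have w_ge0 x : 0 <= w x by exact: diameter_pow_ge0.
have -> : \sum_(0 <= i <oo) diameter_pow s ((uncurry U \o f) i) =
    \esum_(x in setT) w x.
  rewrite -(esum_pred_image w f xpredT) ?[fun=> _]set_true//.
  by rewrite image_eq.
have -> : \esum_(x in setT) w x =
    \sum_(0 <= n <oo) \sum_(0 <= i <oo) diameter_pow s (U n i).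
  pose J : nat -> set (nat * nat) := fun i => [set (i, j) | j in setT].
  have -> : setT = \bigcup_k J k.
    by rewrite predeqE => -[a b]; split => // _; exists a => //; exists b.
  rewrite esum_bigcupT//=; last first.
    apply/trivIsetP => i j _ _ ij.
    rewrite predeqE => -[n m] /=; split => //= -[] [_] _ [<-{n} _].
    by move=> [m' _] [] /esym/eqP; rewrite (negbTE ij).
  rewrite -(image_id [set: nat]) -fun_true esum_pred_image//; last first.
    by move=> n _; exact: esum_ge0.
  apply: eq_eseriesr => /= j _.
  rewrite -(esum_pred_image w (pair j) predT)//=; last first.
    by move=> ? ? _ _; exact: (@can_inj _ _ _ snd).
  by congr esum; rewrite predeqE => -[a b]; split; move=> [i _ <-]; exists i.
apply: le_trans (epsilon_trick0 xpredT (ltW e0)).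
apply: lee_nneseries => [n _ _|n _]; last by have [_ _] := hU n.
by apply: nneseries_ge0 => i _ _; exact: diameter_pow_ge0.
Qed.

(** A cover of [A] is transported along the Lipschitz correspondence [G]:
    diameters grow at most by the factor [L]. *)
Lemma hausdorff_null_lipschitz (R : realType) (s L : R) (A B : set R)
    (G : R -> R -> Prop) :
  (0 <= s)%R -> (0 < L)%R ->
  (forall x y x' y', G x x' -> G y y' -> (`|x' - y'| <= L * `|x - y|)%R) ->
  (forall x', B x' -> exists2 x, A x & G x x') ->
  hausdorff_measure s A = 0 -> hausdorff_measure s B = 0.
Proof.
move=> s0 L0 lip AB /hausdorff_nullP null; apply/hausdorff_nullP => d e d0 e0.
have Ls0 : (0 < L `^ s)%R by rewrite powR_gt0.
have [U [AU Ud Ue]] := null (d / L)%R (e / L `^ s)%R (divr_gt0 d0 L0) (divr_gt0 e0 Ls0).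
have L_ge0 : 0 <= L%:E by rewrite lee_fin ltW.
have Ls_ge0 : 0 <= (L `^ s)%:E by rewrite lee_fin ltW.
pose V i := [set x' | exists2 x, U i x & G x x'].
have VU i : diameter (V i) <= L%:E * diameter (U i).
  rewrite ge_max mule_ge0 ?diameter_ge0//=.
  apply: ge_ereal_sup => _ [[x' y'] [[x Ux xx'] [y Uy yy']] <-] /=.
  apply: le_trans (_ : L%:E * `|x - y|%:E <= _).
    by rewrite -EFinM lee_fin lip.
  by rewrite lee_pmul2l// diameter_ub.
exists V; split.
- move=> x' /AB[x Ax xx']; have [i _ Ux] := AU _ Ax.
  by exists i => //; exists x.
- move=> i; apply: le_trans (VU i) _.
  apply: le_trans (_ : L%:E * (d / L)%:E <= _); first by rewrite lee_pmul2l.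
  by rewrite -EFinM mulrC divfK// gt_eqF.
have pow_le i : diameter_pow s (V i) <= (L `^ s)%:E * diameter_pow s (U i).
  rewrite /diameter_pow; case: eqP => [_|/eqP/set0P[x' [x Ux _]]].
    by rewrite mule_ge0//; case: ifP => // _; exact: poweR_ge0.
  have -> : (U i == set0) = false by apply/negbTE/set0P; exists x.
  rewrite -poweR_EFin -poweRM ?diameter_ge0//.
  apply: gt0_ler_poweR => //; rewrite in_itv/= leey andbT ?diameter_ge0//.
  by rewrite mule_ge0 ?diameter_ge0.
apply: le_trans (lee_nneseries (fun i _ _ => diameter_pow_ge0 s (V i))
  (fun i _ => pow_le i)) _.
rewrite nneseriesZl; last by move=> i _; exact: diameter_pow_ge0.
apply: le_trans (_ : (L `^ s)%:E * (e / L `^ s)%:E <= _).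
  by rewrite lee_pmul2l.
by rewrite -EFinM mulrC divfK// gt_eqF.
Qed.

Lemma hausdorff_dim_le (R : realType) (A B : set R) :
  (forall s : R, (0 <= s)%R -> hausdorff_measure s A = 0 ->
    hausdorff_measure s B = 0) ->
  hausdorff_dim B <= hausdorff_dim A.
Proof.
move=> AB; apply: ereal_inf_le_tmp => _ [s [s0 As] <-].
by exists s => //; split=> //; exact: AB.
Qed.

Local Close Scope ereal_scope.

(** * Digits of summable reciprocals *)

(** [1 + 1 / c i <= expR (2 / (c i + 1))], and the sum of the exponents is at
    most twice the sum of the [1 / psi i], up to the finitely many indices where
    [psi] is not yet a lower bound; each of these contributes at most [2]. *)
Lemma shift_product_bounded (R : realType) (psi : nat -> R) (c : nat -> nat) :
  (forall n, 0 < psi n) ->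
  (\sum_(0 <= n <oo) ((psi n)^-1)%:E < +oo)%E ->
  (forall n, 1 <= c n)%N ->
  (\forall n \near \oo, psi n <= (c n).+1%:R) ->
  exists N : nat, forall n, \prod_(i < n) (1 + (c i)%:R^-1) <= N%:R :> R.
Proof.
move=> psi0 psi_sum c1 [N _ psi_le].
have psi_ge0 n : (0 <= ((psi n)^-1)%:E)%E by rewrite lee_fin invr_ge0 ltW.
set S := (\sum_(0 <= n <oo) _)%E in psi_sum.
have S_fin : S \is a fin_num.
  by rewrite ge0_fin_numE// nneseries_ge0.
have sum_psi n : \sum_(i < n) (psi i)^-1 <= fine S.
  rewrite -lee_fin fineK// -sumEFin -(big_mkord xpredT (fun i => ((psi i)^-1)%:E)).
  exact: nneseries_lim_ge.
pose j i : R := (i < N)%:R.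
have sum_j n : \sum_(i < n) j i <= N%:R.
  rewrite /j -natr_sum ler_nat; have -> : (\sum_(i < n) (i < N) = minn n N)%N.
    by elim: n => [|n IHn]; rewrite ?big_ord0 ?min0n// big_ord_recr /= IHn; lia.
  exact: geq_minr.
have factor_le i : 1 + (c i)%:R^-1 <= expR (2 * (j i + (psi i)^-1)).
  apply: le_trans (expR_ge1Dx _) _; rewrite ler_expR.
  have ci0 : 0 < (c i)%:R :> R by rewrite ltr0n.
  have ci1 : 1 <= (c i)%:R :> R by rewrite ler1n.
  have psi_i : 0 < (psi i)^-1 by rewrite invr_gt0.
  rewrite /j; case: ltnP => [_|Ni].
    have : (c i)%:R^-1 <= 1 :> R by rewrite invf_le1.
    by rewrite mulr1n; lra.
  rewrite mulr0n add0r; apply: le_trans (_ : 2 * (c i).+1%:R^-1 <= _).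
    rewrite ler_pdivlMr ?ltr0n// mulrC ler_pdivrMr// -natr1; lra.
  by rewrite ler_pM2l// lef_pV2 ?posrE ?ltr0n//; exact: psi_le.
have prod_le n : \prod_(i < n) (1 + (c i)%:R^-1) <= expR (2 * (N%:R + fine S)).
  apply: le_trans (_ : \prod_(i < n) expR (2 * (j i + (psi i)^-1)) <= _).
    by apply: ler_prod => i _; rewrite factor_le addr_ge0.
  rewrite -expR_sum ler_expR -mulr_sumr ler_pM2l// big_split.
  by apply: lerD; [exact: sum_j | exact: sum_psi].
exists (Num.bound (expR (2 * (N%:R + fine S)))) => n.
by apply: le_trans (prod_le n) _; apply/ltW/archi_boundP/expR_ge0.
Qed.

(** * Equality of the dimensions *)

Lemma pierce_expansion_mem01 (R : realType) (x : R) q :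
  traditional_pierce_expansion x q -> 0 < x < 1.
Proof.
move=> xq; have [q0 _ _] := xq; have /andP[l u] := pierce_expansion_bounds xq.
rewrite (lt_trans _ l) ?invr_gt0 ?ltr0n//= (lt_le_trans u)//.
by rewrite invf_le1 ?ltr0n// ler1n.
Qed.

(** A number without expansion has digits [0], which [M] excludes, and every sum
    of an expansion is an irrational of the unit interval. *)
Lemma perron_digits_setE (R : realType) (M : set (nat -> nat)) :
  (forall a, M a -> forall n, (1 <= a n)%N) ->
  [set x : R | [/\ 0 < x < 1, irrational x & M (perron_digits x)]] =
  [set x | exists2 c, traditional_pierce_expansion x c & M (fun n => (c n).+1)].
Proof.
move=> M_gt0; apply/seteqP; split=> x /=.
  move=> [_ _]; rewrite /perron_digits.
  case: xgetP => [q _ xq Mq|_ M0]; last by have := M_gt0 _ M0 0%N.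
  have qE : q = fun n => (q n).-1.+1 by apply/funext => n; rewrite prednK// M_gt0.
  by exists (fun n => (q n).-1); [apply/perron_traditional; rewrite -qE|rewrite -qE].
move=> [c xc Mc]; split; first exact: pierce_expansion_mem01 xc.
  exact: pierce_expansion_irrational xc.
by rewrite (perron_digitsE xc).
Qed.

Lemma traditional_digits_setE (R : realType) (M : set (nat -> nat)) :
  (forall a, M a -> forall n, (1 <= a n)%N) ->
  [set x : R | [/\ 0 < x < 1, irrational x & M (traditional_digits x)]] =
  [set x | exists2 c, traditional_pierce_expansion x (fun n => (c n).+1) &
                      M (fun n => (c n).+1)].
Proof.
move=> M_gt0; apply/seteqP; split=> x /=.
  move=> [_ _]; rewrite /traditional_digits.
  case: xgetP => [q _ xq Mq|_ M0]; last by have := M_gt0 _ M0 0%N.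
  have qE : q = fun n => (q n).-1.+1 by apply/funext => n; rewrite prednK// M_gt0.
  by exists (fun n => (q n).-1); rewrite -qE.
move=> [c xc Mc]; split; first exact: pierce_expansion_mem01 xc.
  exact: pierce_expansion_irrational xc.
by rewrite (traditional_digitsE xc).
Qed.

Unset Implicit Arguments.

Theorem mainTheorem3 (R : realType) (psi : nat -> R) (M : set (nat -> nat))
    (psi_gt0 : forall n, 0 < psi n)
    (psi_summable : (\sum_(0 <= n <oo) ((psi n)^-1)%:E < +oo)%E)
    (M_gt0 : forall a, M a -> forall n, (1 <= a n)%N)
    (M_ge : forall a, M a -> \forall n \near \oo, psi n <= (a n)%:R)
    (M_ge2 : forall a, M a -> (2 <= a 0)%N) :
  hausdorff_dim [set x : R | [/\ 0 < x < 1, irrational x & M (perron_digits x)]] =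
  hausdorff_dim [set x : R | [/\ 0 < x < 1, irrational x & M (traditional_digits x)]].
Proof.
rewrite perron_digits_setE// traditional_digits_setE//.
set A := [set x | _]; set B := [set x | _].
apply/eqP; rewrite eq_le; apply/andP; split; apply: hausdorff_dim_le => s s0.
- move=> B0.
  (* The bound is uniform on each piece, and summability makes the pieces cover [A]. *)
  pose bounded (N : nat) (c : nat -> nat) :=
    forall n, \prod_(i < n) (1 + (c i)%:R^-1) <= N%:R :> R.
  pose piece N := [set x : R | exists c, [/\ traditional_pierce_expansion x c,
    M (fun n => (c n).+1) & bounded N c]].
  pose G N (y x : R) := exists c, [/\ traditional_pierce_expansion x c,
    traditional_pierce_expansion y (fun n => (c n).+1) & bounded N c].
  have A_pieces : A `<=` \bigcup_N piece N.
    move=> x [c xc Mc]; have [c0 cS _] := xc.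
    have c_gt0 n : (1 <= c n)%N.
      exact: leq_ltn_trans (leq0n n) (increasing_digits_gt c0 cS n).
    have [N cN] := shift_product_bounded psi_gt0 psi_summable c_gt0 (M_ge _ Mc).
    by exists N => //; exists c.
  apply: hausdorff_null_sub A_pieces _; apply: hausdorff_null_bigcup => N.
  apply: (@hausdorff_null_lipschitz _ s (24 * N.+1%:R) B _ (G N)) => //.
  + move=> y z x w [c [xc yc cN]] [b [wb zb bN]].
    have [_ lip] := pierce_distortion N.+1%:R xc wb yc zb.
    have mono (q : nat -> nat) : bounded N q ->
        forall n, \prod_(i < n) (1 + (q i)%:R^-1) <= N.+1%:R :> R.
      by move=> qN n; apply: le_trans (qN n) _; rewrite ler_nat.
    by apply: lip; exact: mono.
  + move=> x [c [xc Mc cN]]; have [c0 cS _] := xc.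
    have [||y yc] := @pierce_expansion_exists R (fun n => (c n).+1) => //.
    by exists y; [exists c | exists c].
- pose G (x y : R) := exists2 c, traditional_pierce_expansion x c &
    traditional_pierce_expansion y (fun n => (c n).+1).
  apply: (@hausdorff_null_lipschitz _ s 2 A _ G) => //.
  + move=> x w y z [c xc yc] [b wb zb].
    by have [] := pierce_distortion 0 xc wb yc zb.
  + move=> y [c yc Mc]; have [_ cS _] := yc.
    have [||x xc] := @pierce_expansion_exists R c.
    * exact: (M_ge2 _ Mc).
    * by move=> i; have := cS i.
    * by exists x; exists c.
Qed.
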